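(* Let $K$ be a totally real number field and let $\beta\in\mathcal{O}_K^+$ be a squarefree indecomposable element. Then $\beta\mathcal{U}_K^2\in\mathcal{C}^{\mathrm{diag}}_K$.
   Context: $K$ totally real, $\mathcal{O}_K$ its ring of integers, $\mathcal{U}_K$ its unit group, $\mathcal{O}_K^+$ the totally positive integers. $\beta\in\mathcal{O}_K^+$ is indecomposable if it cannot be written as $\beta=\gamma+\delta$ with $\gamma,\delta\in\mathcal{O}_K^+$. $\gamma\in\mathcal{O}_K$ is squarefree if $\omega^2\mid\gamma$ with $\omega\in\mathcal{O}_K$ holds only for $\omega\in\mathcal{U}_K$. For $a_1,\dots,a_n\in\mathcal{O}_K^+$ the diagonal lattice $\langle a_1,\dots,a_n\rangle$ is $\mathcal{O}_K^n$ with $Q(x)=\sum a_ix_i^2$; it represents $\alpha$ if $Q(x)=\alpha$ for some $x$. A class $\alpha\mathcal{U}_K^2\in\mathcal{O}_K^+/\mathcal{U}_K^2$ belongs to $\mathcal{C}^{\mathrm{diag}}_K$ (is diag-critical) if some diagonal lattice does not represent $\alpha$ but represents every element of $\mathcal{O}_K^+$ outside $\alpha\mathcal{U}_K^2$. *)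

(* Defs.v *)
From HB Require Import structures.
From mathcomp Require Import all_boot all_order all_algebra all_field.
From mathcomp Require Import classical_sets.

Set Implicit Arguments.
Unset Strict Implicit.
Unset Printing Implicit Defensive.

Import Order.TTheory GRing.Theory Num.Theory.
Local Open Scope classical_set_scope.
Local Open Scope ring_scope.

(* Number fields are finite extensions of rat.  Their complex embeddings have
   algebraic values, so algC can serve as the target. *)
Definition totally_real (K : fieldExtType rat) : Prop :=
  forall (sigma : {rmorphism K -> algC}) (x : K), sigma x \is Num.real.

Definition ring_of_integers (K : fieldExtType rat) : set K :=
  [set x | integralOver (intr : int -> K) x].

Definition unit_group (K : fieldExtType rat) : set K :=
  [set u | ring_of_integers u /\
           exists2 v : K, ring_of_integers v & u * v = 1].

Definition totally_positive_integers (K : fieldExtType rat) : set K :=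
  [set x | ring_of_integers x /\
           forall sigma : {rmorphism K -> algC}, 0 < sigma x].

Definition indecomposable (K : fieldExtType rat) (beta : K) : Prop :=
  ~ exists gamma delta : K,
      [/\ totally_positive_integers gamma, totally_positive_integers delta
        & beta = gamma + delta].

Definition divides (K : fieldExtType rat) (x y : K) : Prop :=
  exists2 z : K, ring_of_integers z & y = x * z.

Definition squarefree (K : fieldExtType rat) (gamma : K) : Prop :=
  forall omega : K, ring_of_integers omega ->
    divides (omega ^+ 2) gamma -> unit_group omega.

Definition square_class (K : fieldExtType rat) (alpha : K) : set K :=
  [set alpha * u ^+ 2 | u in @unit_group K].

Definition diag_represents (K : fieldExtType rat) (n : nat) (a : 'I_n -> K)
    (alpha : K) : Prop :=
  exists2 x : 'I_n -> K, (forall i, ring_of_integers (x i))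
    & \sum_(i < n) a i * x i ^+ 2 = alpha.

Definition diag_critical_classes (K : fieldExtType rat) : set (set K) :=
  [set square_class alpha | alpha in
    [set alpha : K | totally_positive_integers alpha /\
      exists (n : nat) (a : 'I_n -> K),
        [/\ forall i, totally_positive_integers (a i),
            ~ diag_represents a alpha
          & forall gamma : K, totally_positive_integers gamma ->
              ~ square_class alpha gamma -> diag_represents a gamma]]].

(* Main.v *)
Require Import Defs.
From HB Require Import structures.
From mathcomp Require Import all_boot all_order all_algebra all_field.
From mathcomp Require Import boolp classical_sets zify ring.

Set Implicit Arguments.
Unset Strict Implicit.
Unset Printing Implicit Defensive.

Import Order.TTheory GRing.Theory Num.Theory.
Local Open Scope classical_set_scope.
Local Open Scope ring_scope.

(** A diagonal lattice represents the squarefree indecomposable [beta] only if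
    one of its coefficients lies in [beta U^2]: indecomposability leaves a single
    nonzero term [a x^2], and squarefreeness makes [x] a unit.  So it suffices to
    find a finite set [S] of totally positive integers outside [beta U^2] such
    that every totally positive integer outside [beta U^2] becomes, after
    multiplication by the square of a unit, a sum of elements of [S] with
    repetitions; taking four copies of each element of [S] as coefficients,
    Lagrange's four squares theorem absorbs the multiplicities.

    Such a set exists first without the condition on [beta].  A box argument
    gives a nonzero integer [x] of bounded norm such that [g x^2] has conjugates
    of comparable size; up to units there are finitely many such [x], so [g u^2]
    has conjugates of comparable size for some unit [u].  Dividing [g u^2] with
    remainder by a natural number of that size, coordinatewise in a power basis
    of totally positive integers, writes it as a sum of elements of a fixed
    bounded, hence finite, set [T].  To avoid [beta U^2], group the summands in
    pairs and triples: these are decomposable, while the elements of [beta U^2]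
    are not. *)

(** * Lagrange's four squares theorem *)

Definition sum_of_four_squares (n : nat) : Prop :=
  exists a b c d : int, n%:Z = a ^+ 2 + b ^+ 2 + c ^+ 2 + d ^+ 2.

(** Euler's identity: the norm of quaternions is multiplicative. *)
Lemma sum_of_four_squaresM (m n : nat) :
  sum_of_four_squares m -> sum_of_four_squares n -> sum_of_four_squares (m * n).
Proof.
move=> [a [b [c [d em]]]] [x [y [z [t en]]]].
exists (a * x + b * y + c * z + d * t), (a * y - b * x + c * t - d * z),
  (a * z - c * x + d * y - b * t), (a * t - d * x + b * z - c * y).
by rewrite PoszM em en; ring.
Qed.

(** Pigeonhole in ['F_p] with [p = 2h + 1]: the [h + 1] values [a ^ 2] with [a <= h] are distinct,
    and so are the [h + 1] values [-1 - b ^ 2], so the two sets meet. *)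
Lemma prime_dvd_sum_squares_add1 (p : nat) : prime p -> odd p ->
  exists a b : nat, [/\ (a.*2 < p)%N, (b.*2 < p)%N & (p %| a ^ 2 + b ^ 2 + 1)%N].
Proof.
move=> p_pr p_odd; pose h := p./2.
have ep : p = h.*2.+1 by rewrite -[LHS]odd_double_half p_odd.
have Fp0 (n : nat) : (n%:R == 0 :> 'F_p) = (p %| n)%N.
  by rewrite (dvdn_pcharf (pchar_Fp p_pr)).
pose f (a : 'I_h.+1) : 'F_p := a%:R ^+ 2.
pose g (a : 'I_h.+1) : 'F_p := - 1 - a%:R ^+ 2.
have finj : injective f.
  move=> a b; wlog le_ab : a b / (b <= a)%N.
    by move=> H; case: (leqP b a) => [/H//|/ltnW /H H' e]; symmetry; exact: H'.
  move=> /eqP; rewrite eqf_sqr /f -subr_eq0 -natrB // Fp0 -[X in _ || X]subr_eq0.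
  rewrite opprK -natrD Fp0 => dvd; apply: val_inj => /=.
  have := ltn_ord a; have := ltn_ord b => hb ha.
  case/orP: dvd => /dvdnP [[|k]]; nia.
have ginj : injective g by move=> a b /addrI /oppr_inj; exact: finj.
have [y] : exists y, y \in (f @: [set: 'I_h.+1]%SET) :&: (g @: [set: 'I_h.+1]%SET).
  apply/set0Pn/eqP => dis.
  have : (#|(f @: [set: 'I_h.+1]%SET) :|: (g @: [set: 'I_h.+1]%SET)| <= p)%N.
    by rewrite -[X in (_ <= X)%N](card_Fp p_pr); apply: max_card.
  rewrite cardsU dis cards0 !card_imset // cardsT card_ord.
  by clear -ep; lia.
rewrite inE => /andP [/imsetP [a _ ea] /imsetP [b _ eb]].
exists a, b; have := ltn_ord a; have := ltn_ord b => hb ha; split; try lia.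
rewrite -Fp0 !natrD !natrX; move: ea eb => -> /eqP.
by rewrite /f /g => /eqP ->; apply/eqP; ring.
Qed.

Lemma centered_residue (m : nat) (x : int) : (0 < m)%N ->
  exists y q : int, x = y + m%:Z * q /\ 2%:Z * `|y| <= m%:Z.
Proof.
move=> m_gt0.
have := divz_eq x m%:Z; have := modz_ge0 x (_ : m%:Z != 0).
have := ltz_pmod x (_ : 0 < m%:Z).
set r := (x %% m)%Z; set q := (x %/ m)%Z => h1 h2 e.
have {h1} h1 : r < m%:Z by apply: h1; lia.
have {h2} h2 : 0 <= r by apply: h2; lia.
case: (lerP (2%:Z * r) m%:Z) => h3.
  by exists r, q; split; [rewrite e; ring | lia].
by exists (r - m%:Z), (q + 1); split; [rewrite e; ring | lia].
Qed.

(** The squares of the balanced residues of the coordinates modulo [m] add up to [m * t] with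
    [0 <= t <= m]. The extremes [t = 0] and [t = m] would make [m] divide [p]. Otherwise Euler's
    identity for [m * p] and [m * t] has all components divisible by [m], and dividing by [m ^ 2]
    leaves [t * p]. *)
Lemma four_squares_descent (p m : nat) : prime p -> (1 < m < p)%N ->
  sum_of_four_squares (m * p) ->
  exists2 r : nat, (0 < r < m)%N & sum_of_four_squares (r * p).
Proof.
move=> p_pr /andP [m_gt1 m_lt_p] [a [b [c [d e]]]].
have m_gt0 : (0 < m)%N by lia.
have ndvd (k : int) : p%:Z <> m%:Z * k.
  move=> ek; have mp : (m %| p)%N.
    by apply/dvdnP; exists `|k|%N; move: (congr1 absz ek); rewrite abszM /=; lia.
  by move/primeP: p_pr => [_ /(_ _ mp)]; lia.
have [a' [qa [ea ha]]] := centered_residue a m_gt0.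
have [b' [qb [eb hb]]] := centered_residue b m_gt0.
have [c' [qc [ec hc]]] := centered_residue c m_gt0.
have [d' [qd [ed hd]]] := centered_residue d m_gt0.
rewrite PoszM in e.
pose s := a' ^+ 2 + b' ^+ 2 + c' ^+ 2 + d' ^+ 2.
pose t := p%:Z - (2 * (a' * qa + b' * qb + c' * qc + d' * qd)
   + m%:Z * (qa ^+ 2 + qb ^+ 2 + qc ^+ 2 + qd ^+ 2)).
have es : s = m%:Z * t.
  rewrite /s /t mulrBr e ea eb ec ed; ring.
have sq_le (x : int) : 2%:Z * `|x| <= m%:Z -> 4%:Z * x ^+ 2 <= m%:Z ^+ 2.
  move=> hx; rewrite -real_normK ?num_real // -subr_ge0.
  have -> : m%:Z ^+ 2 - 4%:Z * `|x| ^+ 2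
    = (m%:Z - 2%:Z * `|x|) * (m%:Z + 2%:Z * `|x|) by ring.
  by rewrite mulr_ge0 // ?subr_ge0 // addr_ge0 // mulr_ge0.
have sq_eq (x : int) : 4%:Z * x ^+ 2 = m%:Z ^+ 2 ->
    2%:Z * x = m%:Z \/ 2%:Z * x = - m%:Z.
  move=> ex; have /eqP : (2%:Z * x - m%:Z) * (2%:Z * x + m%:Z) = 0.
    by rewrite -(subrr (m%:Z ^+ 2)) -{1}ex; ring.
  by rewrite mulf_eq0 subr_eq0 addr_eq0 => /orP [] /eqP; [left | right].
have t_ge0 : 0 <= t.
  have : 0 <= s by rewrite /s !addr_ge0 ?sqr_ge0.
  by rewrite es pmulr_rge0 //; lia.
have t_le : t <= m%:Z.
  have : 4%:Z * s <= 4%:Z * m%:Z ^+ 2.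
    have -> : 4%:Z * m%:Z ^+ 2 = m%:Z ^+ 2 + m%:Z ^+ 2 + m%:Z ^+ 2 + m%:Z ^+ 2.
      by ring.
    by rewrite /s !mulrDr !lerD // sq_le.
  by rewrite es expr2 ler_pM2l // ler_pM2l //; lia.
have t_neq0 : t <> 0.
  move=> t0; rewrite t0 mulr0 in es.
  have z0 : [/\ a' = 0, b' = 0, c' = 0 & d' = 0].
    move/eqP: es; rewrite /s !paddr_eq0 ?addr_ge0 ?sqr_ge0 // !sqrf_eq0.
    by move=> /andP [/andP [/andP [/eqP -> /eqP ->] /eqP ->] /eqP ->].
  case: z0 => za zb zc zd; apply: (ndvd (qa ^+ 2 + qb ^+ 2 + qc ^+ 2 + qd ^+ 2)).
  move/eqP: t0; rewrite /t subr_eq0 => /eqP ->.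
  by rewrite za zb zc zd; ring.
have t_neqm : t <> m%:Z.
  move=> tm; rewrite tm in es.
  (* Four terms, each at most [m ^ 2], add up to [4 * m ^ 2], so every bound is attained. *)
  have eq4 : [/\ 4%:Z * a' ^+ 2 = m%:Z ^+ 2, 4%:Z * b' ^+ 2 = m%:Z ^+ 2,
      4%:Z * c' ^+ 2 = m%:Z ^+ 2 & 4%:Z * d' ^+ 2 = m%:Z ^+ 2].
    have := (sq_le _ ha, sq_le _ hb, sq_le _ hc, sq_le _ hd) => -[[[]]].
    move: es; rewrite /s -expr2; move: (a' ^+ 2) (b' ^+ 2) (c' ^+ 2) (d' ^+ 2).
    by move: (m%:Z ^+ 2); clear; split; lia.
  case: eq4 => qa4 qb4 qc4 qd4.
  have half (x q : int) : 4%:Z * x ^+ 2 = m%:Z ^+ 2 ->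
      exists k : int, 2 * (x * q) = m%:Z * k.
    move=> ex; case: (sq_eq _ ex) => h; [exists q | exists (- q)].
      by rewrite mulrA h.
    by rewrite mulrA h; ring.
  have [ka eka] := half _ qa qa4; have [kb ekb] := half _ qb qb4.
  have [kc ekc] := half _ qc qc4; have [kd ekd] := half _ qd qd4.
  apply: (ndvd (1 + ka + kb + kc + kd + (qa ^+ 2 + qb ^+ 2 + qc ^+ 2 + qd ^+ 2))).
  move/eqP: tm; rewrite /t subr_eq => /eqP ->.
  by rewrite !(mulrDr m%:Z) mulr1 -eka -ekb -ekc -ekd; ring.
exists `|t|%N; first by clear -t_ge0 t_le t_neq0 t_neqm; lia.
(* The [m * z_i] are the components in Euler's identity for the product of
   [m * p] and [m * t]. *)
pose z1 := p%:Z - (a * qa + b * qb + c * qc + d * qd).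
pose z2 := - a * qb + b * qa - c * qd + d * qc.
pose z3 := - a * qc + c * qa - d * qb + b * qd.
pose z4 := - a * qd + d * qa - b * qc + c * qb.
exists z1, z2, z3, z4.
rewrite PoszM gez0_abs //.
have m0 : m%:Z ^+ 2 != 0 by rewrite expf_neq0 //; lia.
apply: (mulfI m0).
have -> : m%:Z ^+ 2 * (t * p%:Z) = s * (m%:Z * p%:Z) by rewrite es; ring.
have -> : m%:Z ^+ 2 * (z1 ^+ 2 + z2 ^+ 2 + z3 ^+ 2 + z4 ^+ 2)
  = (m%:Z * z1) ^+ 2 + (m%:Z * z2) ^+ 2 + (m%:Z * z3) ^+ 2 + (m%:Z * z4) ^+ 2
  by ring.
rewrite {1}/z1 mulrBr e /s /z2 /z3 /z4.
have -> : a' = a - m%:Z * qa by rewrite ea; ring.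
have -> : b' = b - m%:Z * qb by rewrite eb; ring.
have -> : c' = c - m%:Z * qc by rewrite ec; ring.
have -> : d' = d - m%:Z * qd by rewrite ed; ring.
ring.
Qed.

Lemma prime_sum_of_four_squares (p : nat) :
  prime p -> sum_of_four_squares p.
Proof.
move=> p_pr; have [p2|p_odd] := even_prime p_pr.
  by exists 1, 1, 0, 0; rewrite p2.
have [a [b [ha hb /dvdnP [m em]]]] := prime_dvd_sum_squares_add1 p_pr p_odd.
have p_gt1 := prime_gt1 p_pr.
have mp : sum_of_four_squares (m * p).
  by exists a%:Z, b%:Z, 1, 0; rewrite -em; lia.
(* Both [2a] and [2b] are below [p], so [m * p = a ^ 2 + b ^ 2 + 1 < p ^ 2]. *)
have m_bnd : (0 < m < p)%N by nia.
elim/ltn_ind: m m_bnd mp {em} => m IH /andP [m_gt0 m_lt] mp.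
have [m1|m_gt1] : m = 1%N \/ (1 < m)%N by lia.
  by rewrite m1 mul1n in mp.
have [|r /andP [r_gt0 r_lt]] := four_squares_descent p_pr _ mp; first by rewrite m_gt1.
by apply: IH => //; rewrite r_gt0 (ltn_trans r_lt).
Qed.

Theorem lagrange_four_squares (n : nat) : sum_of_four_squares n.
Proof.
elim/ltn_ind: n => n IH.
have [n0|[n1|n_gt1]] : n = 0%N \/ n = 1%N \/ (1 < n)%N by lia.
- by exists 0, 0, 0, 0; rewrite n0.
- by exists 1, 0, 0, 0; rewrite n1.
have /dvdnP [k ek] := pdiv_dvd n.
have p_gt1 := prime_gt1 (pdiv_prime n_gt1).
rewrite ek; apply: sum_of_four_squaresM; last exact/prime_sum_of_four_squares/pdiv_prime.
by apply: IH; nia.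
Qed.

(** * Embeddings of a number field into the complex numbers *)

Section Embeddings.
Variable K : fieldExtType rat.
Implicit Types (x y theta : K) (p q P : {poly rat}).

Definition rat_eval theta p : K := (map_poly (in_alg K) p).[theta].

Lemma rat_evalD theta p q : rat_eval theta (p + q) = rat_eval theta p + rat_eval theta q.
Proof. by rewrite /rat_eval rmorphD hornerD. Qed.

Lemma rat_evalB theta p q : rat_eval theta (p - q) = rat_eval theta p - rat_eval theta q.
Proof. by rewrite /rat_eval rmorphB hornerD hornerN. Qed.

Lemma rat_evalM theta p q : rat_eval theta (p * q) = rat_eval theta p * rat_eval theta q.
Proof. by rewrite /rat_eval rmorphM hornerM. Qed.

Lemma rmorph_rat_eval (tau : {rmorphism K -> algC}) theta p :
  tau (rat_eval theta p) = (map_poly ratr p).[tau theta].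
Proof.
rewrite /rat_eval -horner_map -map_poly_comp; congr (_.[_]).
by apply: eq_map_poly => a; exact: (fmorph_eq_rat (tau \o in_alg K)).
Qed.

(** Primitive element theorem, available since characteristic zero makes [K] separable; [P] is the
    minimal polynomial of [theta]. *)
Lemma primitive_rat_poly : exists theta P, [/\ P \is monic, separable_poly P,
   forall x, exists p, x = rat_eval theta p &
   forall p, (rat_eval theta p == 0) = (P %| p)].
Proof.
have sepK : separable 1%AS {:K}%AS.
  apply/separableP => y _; apply: pcharf0_separable => q.
  by rewrite (fmorph_pchar (in_alg K)) pchar_num.
have := eq_adjoin_separable_generator sepK (sub1v _).
set theta := separable_generator _ _ => gen.
have /polyOver1P [P eP] := minPolyOver 1%AS theta.
have eP' : map_poly (in_alg K) P = minPoly 1%AS theta by rewrite -eP.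
exists theta, P; split.
- by rewrite -(map_monic (in_alg K)) eP' monic_minPoly.
- by rewrite -(separable_map (in_alg K)) eP'; exact: separable_generatorP.
- move=> x; have /Fadjoin_polyP [q q1 ->] : x \in <<1%AS; theta>>%VS.
    by rewrite -gen memvf.
  by move/polyOver1P: q1 => [p ->]; exists p.
- move=> p; rewrite -(dvdp_map (in_alg K)) eP'; apply/eqP/idP => [p0|].
    by apply: minPoly_dvdp; [apply/polyOver1P; exists p | apply/rootP].
  move=> /dvdpP [q]; rewrite /rat_eval => ->.
  by rewrite hornerM minPolyxx mulr0.
Qed.

(** [K] is the quotient of the rational polynomials by [P], so evaluation at a root [z] does not
    depend on the chosen representative. *)
Lemma embedding_of_root theta P (z : algC) :
   (forall x, exists p, x = rat_eval theta p) ->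
   (forall p, (rat_eval theta p == 0) = (P %| p)) ->
   root (map_poly ratr P) z ->
   exists sigma : {rmorphism K -> algC}, sigma theta = z.
Proof.
move=> surj ker rz.
have [rep repE] := choice surj.
have evE p q : rat_eval theta p = rat_eval theta q ->
    (map_poly ratr p).[z] = (map_poly ratr q).[z] :> algC.
  move=> e; apply/eqP; rewrite -subr_eq0 -hornerN -hornerD -rmorphB.
  have : P %| p - q by rewrite -ker rat_evalB e subrr.
  by move=> /dvdpP [r ->]; rewrite rmorphM hornerM (rootP rz) mulr0.
pose f x : algC := (map_poly ratr (rep x)).[z].
have fE p : f (rat_eval theta p) = (map_poly ratr p).[z] by apply: evE; rewrite -repE.
have fB : zmod_morphism f.
  move=> x y; have [[p ->] [q ->]] := (surj x, surj y).
  by rewrite -rat_evalB !fE rmorphB hornerD hornerN.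
have fM : monoid_morphism f.
  split=> [|x y].
    have -> : 1 = rat_eval theta 1 by rewrite /rat_eval rmorph1 hornerC.
    by rewrite fE rmorph1 hornerC.
  have [[p ->] [q ->]] := (surj x, surj y).
  by rewrite -rat_evalM !fE rmorphM hornerM.
pose fA := GRing.isZmodMorphism.Build _ _ f fB.
pose fR := GRing.isMonoidMorphism.Build _ _ f fM.
pose F : {rmorphism K -> algC} := HB.pack f fA fR.
exists F; have -> : theta = rat_eval theta 'X by rewrite /rat_eval map_polyX hornerX.
by rewrite /= fE map_polyX hornerX.
Qed.

(** Embeddings correspond to the roots of the minimal polynomial of a primitive element, which are
    distinct by separability. *)
Lemma primitive_embeddings : exists (d : nat) (sigma : 'I_d -> {rmorphism K -> algC}) theta,
  [/\ forall tau : {rmorphism K -> algC}, exists i, tau =1 sigma i,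
      injective (fun i => sigma i theta)
    & forall x, exists2 p : {poly rat}, (size p <= d)%N & x = rat_eval theta p].
Proof.
have [theta [P [P_mon P_sep surj ker]]] := primitive_rat_poly.
have [r er] := closed_field_poly_normal (map_poly (ratr : rat -> algC) P).
have Pr_mon : map_poly (ratr : rat -> algC) P \is monic by rewrite map_monic.
rewrite (monicP Pr_mon) scale1r in er.
have r_uniq : uniq r by rewrite -separable_prod_XsubC -er separable_map.
have rootr z : root (map_poly ratr P) z = (z \in r) by rewrite er root_prod_XsubC.
have szP : size P = (size r).+1.
  by rewrite -(size_map_poly (ratr : {rmorphism rat -> algC})) er size_prod_XsubC.
have /choice [sigma sigmaE] : forall i : 'I_(size r),
    exists s : {rmorphism K -> algC}, s theta = r`_i.
  move=> i; apply: (embedding_of_root surj ker).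
  by rewrite rootr mem_nth.
exists (size r), sigma, theta; split.
- move=> tau; have tr : tau theta \in r.
    rewrite -rootr; apply/rootP; rewrite -rmorph_rat_eval.
    by apply/eqP; rewrite fmorph_eq0 ker.
  have lt_i : (index (tau theta) r < size r)%N by rewrite index_mem.
  exists (Ordinal lt_i) => x; have [p ->] := surj x.
  by rewrite !rmorph_rat_eval sigmaE nth_index.
- move=> i j; rewrite !sigmaE => /eqP; rewrite nth_uniq // => /eqP; exact: val_inj.
- move=> x; have [p ->] := surj x; exists (p %% P).
    by rewrite -ltnS -szP ltn_modp -size_poly_gt0 szP.
  rewrite [in LHS](divp_eq p P) rat_evalD rat_evalM.
  by have /eqP -> : rat_eval theta P == 0; rewrite ?ker // mulr0 add0r.
Qed.

Lemma integer_multiple x :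
  exists2 a : int, a != 0 & ring_of_integers (a%:~R * x).
Proof.
have /polyOver1P [P eP] := minPolyOver 1%AS x.
have [q [a a_neq0 ePq]] := rat_poly_scale P.
have eq_x : map_poly (in_alg K) P = minPoly 1%AS x by rewrite -eP.
have P_mon : P \is monic by rewrite -(map_monic (in_alg K)) eq_x monic_minPoly.
have a0 : a%:~R != 0 :> rat by rewrite intr_eq0.
have eqP : map_poly intr q = a%:~R *: P :> {poly rat} by rewrite ePq scalerA divff ?scale1r.
have sz_q : size q = size P.
  by rewrite ePq size_scale ?invr_eq0 // size_map_inj_poly //; exact: intr_inj.
have lead_q : q`_(size P).-1 = a.
  apply: (@intr_inj rat); rewrite -[LHS]coef_map eqP coefZ -lead_coefE.
  by rewrite (monicP P_mon) mulr1.
have qx0 : (map_poly intr q).[x] = 0 :> K.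
  have -> : map_poly intr q = map_poly (in_alg K) (map_poly intr q).
    by rewrite -map_poly_comp; apply: eq_map_poly => c; exact/esym/(rmorph_int (in_alg K)).
  by rewrite eqP linearZ /= hornerZ eq_x minPolyxx mulr0.
have : (1 < size P)%N.
  by rewrite -(size_map_poly (in_alg K)) eq_x size_minPoly.
case: (size P) sz_q lead_q => [//|[//|n]] sz_q /= lead_q _.
exists a => //.
(* As [q] has degree [n + 1] and leading coefficient [a], this is [a ^ n * q(X / a)], monic with
   integer coefficients. *)
exists (\poly_(i < n.+2) (if i == n.+1 then 1 else q`_i * a ^+ (n - i))).
  by rewrite monicE lead_coef_poly ?eqxx ?oner_eq0.
apply/rootP; rewrite (@horner_coef_wide _ n.+2); last first.
  by apply: leq_trans (size_poly _ _) _; rewrite size_poly.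
transitivity (a%:~R ^+ n * (map_poly intr q).[x] : K); last by rewrite qx0 mulr0.
rewrite (@horner_coef_wide _ n.+2); last first.
  by apply: leq_trans (size_poly _ _) _; rewrite sz_q.
rewrite mulr_sumr; apply: eq_bigr => i _.
rewrite !coef_map coef_poly ltn_ord exprMn.
have [ei|ne_i] := eqVneq (i : nat) n.+1.
  by rewrite ei lead_q /= mulr1z mul1r exprSr; ring.
have le_in : (i <= n)%N by rewrite -ltnS ltn_neqAle ne_i -ltnS /=.
rewrite /= intrM rmorphXn /=.
have -> : a%:~R ^+ n = a%:~R ^+ (n - i) * a%:~R ^+ i :> K by rewrite -exprD subnK.
by rewrite !mulrA; congr (_ * _); ring.
Qed.

End Embeddings.

(** * Algebraic integers and a totally positive power basis *)

Lemma seq_of_injective (T : eqType) (F : finType) (P : T -> Prop) (f : T -> F) :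
  (forall x y, P x -> P y -> f x = f y -> x = y) ->
  exists s : seq T, forall x, P x -> x \in s.
Proof.
move=> f_inj.
have /choice [g gE] : forall y, exists o : option T,
    forall x, P x -> f x = y -> o = Some x.
  move=> y; have [[x [Px fx]]|nx] := pselect (exists x, P x /\ f x = y).
    by exists (Some x) => z Pz fz; rewrite (f_inj x z) // fx fz.
  by exists None => x Px fx; case: nx; exists x.
exists (pmap g (enum F)) => x Px.
by rewrite mem_pmap -(gE (f x) x Px erefl) map_f // mem_enum.
Qed.

Lemma real_family_bound (I : finType) (f : I -> algC) :
  (forall i, f i \is Num.real) ->
  exists2 n : nat, (0 < n)%N & forall i, f i <= n%:R.
Proof.
move=> f_real; exists (\max_i (Num.truncn (f i))).+1 => // i.
apply/ltW/(lt_le_trans (real_truncnS_gt (f_real i))).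
by rewrite ler_nat ltnS leq_bigmax.
Qed.

Section Integers.
Variable K : fieldExtType rat.
Implicit Types x y : K.
Local Notation O := (@ring_of_integers K).

Lemma integerD x y : O x -> O y -> O (x + y).
Proof. exact: integral_add. Qed.

Lemma integerB x y : O x -> O y -> O (x - y).
Proof. exact: integral_sub. Qed.

Lemma integerM x y : O x -> O y -> O (x * y).
Proof. exact: integral_mul. Qed.

Lemma integer_int (n : int) : O n%:~R.
Proof. exact: integral_id. Qed.

Lemma integer_nat (n : nat) : O n%:R.
Proof. exact: (integer_int n). Qed.

Lemma integerX x n : O x -> O (x ^+ n).
Proof.
move=> Ox; elim: n => [|n IH]; first exact: (integer_nat 1).
by rewrite exprS; apply: integerM.
Qed.

Lemma integer_sum (I : Type) (r : seq I) (F : I -> K) :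
  (forall i, O (F i)) -> O (\sum_(i <- r) F i).
Proof.
move=> OF; elim/big_ind: _ => //; first exact: (integer_nat 0).
by move=> x y; apply: integerD.
Qed.

Lemma integer_Aint (tau : {rmorphism K -> algC}) x : O x -> tau x \in Aint.
Proof.
move=> [p p_mon /rootP px0].
apply: (@root_monic_Aint (map_poly intr p)).
- have -> : map_poly intr p = map_poly tau (map_poly intr p) :> {poly algC}.
    by rewrite -map_poly_comp; apply: eq_map_poly => c; rewrite /= rmorph_int.
  by apply/rootP; rewrite horner_map px0 rmorph0.
- exact: monic_map.
- by apply/polyOverP => i; rewrite coef_map /= intr_int.
Qed.

(** The minimal polynomial of [tau x] also vanishes at [x], as [tau] is injective; integrality can
    thus be tested at a single embedding. *)
Lemma Aint_integer (tau : {rmorphism K -> algC}) x : tau x \in Aint -> O x.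
Proof.
rewrite unfold_in => /floorpP [p ep].
have p_mon : p \is monic.
  have := minCpoly_monic (tau x); rewrite ep !monicE lead_coef_map_inj //.
    by move=> /eqP h; apply/eqP/(@intr_inj algC).
  exact: intr_inj.
exists p => //; have := root_minCpoly (tau x); rewrite ep.
have -> : map_poly intr p = map_poly tau (map_poly intr p) :> {poly algC}.
  by rewrite -map_poly_comp; apply: eq_map_poly => c; rewrite /= rmorph_int.
by rewrite fmorph_root.
Qed.

End Integers.

Section PowerBasis.
Variables (K : fieldExtType rat) (d : nat) (sigma : 'I_d -> {rmorphism K -> algC}).
Variable theta : K.
Local Notation O := (@ring_of_integers K).
Implicit Types x y : K.

(** Injectivity makes the Vandermonde matrix of the conjugates invertible. The powers of [theta]
    span [K] over the rationals, while [O] may exceed their integer span; hence the rational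
    remainders below. *)
Definition totally_positive_power_basis : Prop :=
  [/\ O theta /\ (forall i, 0 < sigma i theta),
      injective (fun i => sigma i theta),
      forall x, exists c : 'I_d -> rat, x = \sum_k c k *: theta ^+ k
    & forall tau : {rmorphism K -> algC}, exists i, tau =1 sigma i].

End PowerBasis.

Lemma totally_real_power_basis (K : fieldExtType rat) : totally_real K ->
  exists (d : nat) (sigma : 'I_d -> {rmorphism K -> algC}) theta,
    totally_positive_power_basis sigma theta.
Proof.
move=> hK; have [d [sigma [theta [all_emb inj gen]]]] := primitive_embeddings K.
have [a a0 Oa] := integer_multiple theta.
have [|n n0 n_gt] := @real_family_bound _ (fun i => - sigma i (a%:~R * theta)).
  by move=> i; rewrite rpredN.
(* The conjugates of [a * theta] are at least [- n], so the shift by [n + 1] makes them strictly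
   positive. *)
pose m : int := n.+1; pose eta := a%:~R * theta + m%:~R.
have a0K : a%:~R != 0 :> K.
  by rewrite -(rmorph_int (in_alg K)) fmorph_eq0 intr_eq0.
have eth : theta = (a%:~R)^-1 * (eta - m%:~R) by rewrite /eta addrK mulKf.
exists d, sigma, eta; split=> //.
- split=> [|i]; first by apply: integerD => //; exact: integer_int.
  rewrite /eta rmorphD rmorph_int.
  rewrite -ltrBlDl sub0r; apply: le_lt_trans (n_gt i) _.
  by rewrite /m -pmulrn ltr_nat.
- move=> i j /=; rewrite /eta !rmorphD !rmorphM !rmorph_int => /addIr.
  by move/mulfI => /(_ _)/inj -> //; rewrite intr_eq0.
- move=> x; have [p sz_p ->] := gen x.
  pose q := p \Po ((a%:~R^-1)%:P * ('X - (m%:~R)%:P)).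
  have sz_q : (size q <= d)%N.
    apply: leq_trans sz_p; rewrite size_comp_poly2 //.
    by rewrite mul_polyC size_scale ?size_XsubC // invr_eq0 intr_eq0.
  exists (fun k => q`_k).
  transitivity (rat_eval eta q).
    rewrite /rat_eval map_comp_poly horner_comp; congr (_.[_]).
    rewrite rmorphM rmorphB /= map_polyX !map_polyC /= !hornerE /=.
    by rewrite -!in_algE fmorphV !rmorph_int -eth.
  rewrite /rat_eval (@horner_coef_wide _ d).
    by apply: eq_bigr => k _; rewrite coef_map /= -scalerAl mul1r.
  by apply: leq_trans (size_poly _ _) _.
Qed.

(** * Norms, traces and boxes *)

Section Conjugates.
Variables (K : fieldExtType rat) (d : nat) (sigma : 'I_d -> {rmorphism K -> algC}).
Variable theta : K.
Hypothesis hK : totally_real K.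
Hypothesis hB : totally_positive_power_basis sigma theta.
Local Notation O := (@ring_of_integers K).
Implicit Types x y : K.

Let V := Vandermonde d (\row_i sigma i theta).

Lemma conj_vandermonde_unit : V \in unitmx.
Proof.
have [_ inj _ _] := hB.
rewrite unitmxE det_Vandermonde unitfE.
apply/prodf_neq0 => i _; apply/prodf_neq0 => j lt_ij.
rewrite !mxE subr_eq0; apply/eqP => /inj eij.
by rewrite eij ltnn in lt_ij.
Qed.

Lemma conj_pow_sum_eq0 (c : 'I_d -> algC) :
  (forall i, \sum_k c k * sigma i theta ^+ k = 0) -> forall k, c k = 0.
Proof.
move=> c0 k; have : (\row_k c k) *m V = 0.
  apply/rowP => i; rewrite !mxE -[RHS](c0 i).
  by apply: eq_bigr => j _; rewrite !mxE.
move/(congr1 (mulmx^~ (invmx V))); rewrite mul0mx (mulmxK conj_vandermonde_unit).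
by move/rowP => /(_ k); rewrite !mxE.
Qed.

(** Applied to conjugates, this shows that an element is determined by the traces of its products
    with the powers of [theta]. *)
Lemma conj_eq0_of_power_sums (y : 'I_d -> algC) :
  (forall k : 'I_d, \sum_i y i * sigma i theta ^+ k = 0) -> forall i, y i = 0.
Proof.
move=> y0 i; have : V *m (\col_i y i) = 0.
  apply/colP => k; rewrite !mxE -[RHS](y0 k).
  by apply: eq_bigr => j _; rewrite !mxE mulrC.
move/(congr1 (mulmx (invmx V))); rewrite mulmx0 (mulKmx conj_vandermonde_unit).
by move/colP => /(_ i); rewrite !mxE.
Qed.

(* The conjugates of [x] are the eigenvalues of the rational matrix of
   multiplication by [x] in the power basis, diagonalised by [V]. *)
Lemma conj_diagonalisation x : exists M : 'M[rat]_d,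
  map_mx ratr M = V *m diag_mx (\row_i sigma i x) *m invmx V :> 'M[algC]_d.
Proof.
have [_ _ gen _] := hB.
have /choice [c cE] := fun k : 'I_d => gen (x * theta ^+ k).
exists (\matrix_(k, j) c k j); rewrite -[LHS](mulmxK conj_vandermonde_unit).
congr (_ *m _); apply/matrixP => k i; rewrite mul_mx_diag !mxE.
transitivity (sigma i (x * theta ^+ k)).
  rewrite cE rmorph_sum; apply: eq_bigr => j _.
  by rewrite !mxE rmorphZ_num rmorphXn.
by rewrite rmorphM rmorphXn mulrC.
Qed.

Definition conj_norm x : algC := \prod_i sigma i x.
Definition conj_trace x : algC := \sum_i sigma i x.

(** The norm is the determinant of a rational matrix and a product of algebraic integers; a rational
    algebraic integer is an integer. *)
Lemma conj_norm_int x : O x -> conj_norm x \in Num.int.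
Proof.
move=> Ox; apply: Cint_rat_Aint; last first.
  by apply: rpred_prod => i _; apply: integer_Aint.
have [M eM] := conj_diagonalisation x.
have := congr1 determinant eM.
rewrite det_map_mx !det_mulmx mulrAC -det_mulmx mulmxV ?conj_vandermonde_unit //.
rewrite det1 mul1r det_diag => eq_det.
suff -> : conj_norm x = ratr (\det M) by apply: Crat_rat.
by rewrite eq_det; apply: eq_bigr => i _; rewrite mxE.
Qed.

Lemma conj_trace_int x : O x -> conj_trace x \in Num.int.
Proof.
move=> Ox; apply: Cint_rat_Aint; last first.
  by apply: rpred_sum => i _; apply: integer_Aint.
have [M eM] := conj_diagonalisation x.
have := congr1 mxtrace eM.
rewrite trace_map_mx mxtrace_mulC mulmxA mulVmx ?conj_vandermonde_unit //.
rewrite mul1mx mxtrace_diag => eq_tr.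
suff -> : conj_trace x = ratr (\tr M) by apply: Crat_rat.
by rewrite eq_tr; apply: eq_bigr => i _; rewrite mxE.
Qed.

Lemma dim_gt0 : (0 < d)%N.
Proof.
have [_ _ gen _] := hB; case: d sigma gen => // s gen.
by have [c /eqP] := gen 1; rewrite big_ord0 oner_eq0.
Qed.

Lemma sigma_real i x : sigma i x \is Num.real. Proof. exact: hK. Qed.

(** The traces of [x * theta ^ k] determine [x], and they are integers of bounded size. *)
Lemma finite_box (B : nat) : exists s : seq K, forall x,
  O x -> (forall i, `|sigma i x| <= B%:R) -> x \in s.
Proof.
have [[Oth th_gt0] _ _ _] := hB.
have [|N N_gt0 hN] := @real_family_bound _
    (fun k : 'I_d => \sum_i B%:R * sigma i theta ^+ k).
  by move=> k; apply: rpred_sum => i _; rewrite realM ?realX ?sigma_real ?realn.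
pose P x := O x /\ (forall i, `|sigma i x| <= B%:R).
(* The shift by [N] turns integers between [- N] and [N] into naturals up to [2N], which fit an
   ordinal type. *)
pose t x (k : 'I_d) := conj_trace (x * theta ^+ k) + N%:R.
have tP x k : P x -> t x k \in Num.nat /\ t x k <= (N + N)%:R.
  move=> [Ox hx].
  have tr_le : `|conj_trace (x * theta ^+ k)| <= N%:R.
    apply: le_trans (hN k); apply: le_trans (ler_norm_sum _ _ _) _.
    apply: ler_sum => i _; rewrite rmorphM rmorphXn normrM.
    by rewrite (ger0_norm (exprn_ge0 _ (ltW (th_gt0 i)))) ler_wpM2r // exprn_ge0 // ltW.
  have tr_int : conj_trace (x * theta ^+ k) \in Num.int.
    by apply: conj_trace_int; apply: integerM => //; exact: integerX.
  have /andP [tr_ge tr_le'] : - N%:R <= conj_trace (x * theta ^+ k) <= N%:R.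
    by rewrite -real_ler_norml // Rreal_int.
  split; last by rewrite natrD lerD2r.
  by rewrite natrEint rpredD ?natr_int //= -lerBlDr sub0r.
have [|s hs] := @seq_of_injective K {ffun 'I_d -> 'I_(N + N).+1} P
  (fun x => [ffun k => inord (Num.truncn (t x k))]); last first.
  by exists s => x Ox hx; apply: hs; split.
move=> x y Px Py /ffunP exy; have [Ox _] := Px; have [Oy _] := Py.
have et k : t x k = t y k.
  have [[nx bx] [ny by_]] := (tP x k Px, tP y k Py).
  rewrite -[LHS](truncnK nx) -[RHS](truncnK ny); congr (_%:R).
  have /(congr1 val) := exy k; rewrite !ffunE /= !inordK //.
    by rewrite ltnS -(ler_nat algC) truncnK.
  by rewrite ltnS -(ler_nat algC) truncnK.
have i0 : 'I_d by apply: (Ordinal dim_gt0).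
apply/eqP; rewrite -subr_eq0 -(fmorph_eq0 (sigma i0)); apply/eqP.
apply: (@conj_eq0_of_power_sums (fun i => sigma i (x - y))) => k.
have /addIr/eqP := et k; rewrite -subr_eq0 /conj_trace -sumrB => /eqP e0.
by rewrite -[RHS]e0; apply: eq_bigr => i _; rewrite !rmorphM rmorphB rmorphXn mulrBl.
Qed.

Lemma power_basis_division (m : nat) x : (0 < m)%N ->
  exists (z : 'I_d -> int) (f : 'I_d -> rat),
    (forall k, 0 <= f k < m%:R) /\
    x = m%:R * (\sum_k (z k)%:~R * theta ^+ k) + \sum_k f k *: theta ^+ k.
Proof.
move=> m_gt0; have [_ _ gen _] := hB; have [c ->] := gen x.
have m0 : 0 < m%:R :> rat by rewrite ltr0n.
pose z k := Num.floor (c k / m%:R).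
exists z, (fun k => c k - m%:R * (z k)%:~R); split=> [k|].
  have := Num.Theory.floor_itv (c k / m%:R); rewrite -/(z k) => /andP [h1 h2].
  rewrite subr_ge0 mulrC -ler_pdivlMr // h1.
  by rewrite ltrBlDl -[X in _ < _ + X]mul1r -mulrDl -ltr_pdivrMr // -[1]mulr1z -intrD.
rewrite mulr_sumr -big_split; apply: eq_bigr => k _ /=.
rewrite scalerBl addrCA mulrA.
suff -> : (m%:R * (z k)%:~R) *: theta ^+ k = m%:R * (z k)%:~R * theta ^+ k.
  by rewrite subrr addr0.
by rewrite -[in LHS](mul1r (theta ^+ k)) scalerAl -in_algE rmorphM rmorph_nat rmorph_int.
Qed.

(** As the conjugates of [theta] are positive, each conjugate increases with the coefficients; [E]
    bounds the conjugates of the sum of the powers. *)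
Lemma power_basis_box : exists2 E : nat, (0 < E)%N &
  forall (m : nat) (f : 'I_d -> rat), (forall k, 0 <= f k <= m%:R) ->
  forall i, 0 <= sigma i (\sum_k f k *: theta ^+ k) <= (m * E)%:R.
Proof.
have [[Oth th_gt0] _ _ _] := hB.
have [|E E_gt0 hE] := @real_family_bound _
    (fun i : 'I_d => \sum_(k < d) sigma i theta ^+ k).
  by move=> i; apply: rpred_sum => k _; rewrite realX ?sigma_real.
exists E => // m f hf i; rewrite rmorph_sum.
have th0 (k : 'I_d) : 0 <= sigma i theta ^+ k by rewrite exprn_ge0 // ltW.
have f0 k : 0 <= ratr (f k) :> algC by rewrite ler0q; case/andP: (hf k).
apply/andP; split.
  by apply: sumr_ge0 => k _; rewrite rmorphZ_num rmorphXn mulr_ge0.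
rewrite natrM; apply: le_trans (ler_wpM2l (ler0n _ m) (hE i)).
rewrite mulr_sumr; apply: ler_sum => k _.
rewrite rmorphZ_num rmorphXn ler_wpM2r //.
by have /andP [_] := hf k; rewrite -(ler_rat algC) rmorph_nat.
Qed.

End Conjugates.

(** * Balancing by unit squares *)

Lemma dist_eq_truncn (u v : algC) : 0 <= u -> 0 <= v ->
  Num.truncn u = Num.truncn v -> `|u - v| <= 1.
Proof.
move=> u0 v0 e; have /andP [u1 u2] := truncn_itv u0.
have /andP [v1 v2] := truncn_itv v0; rewrite -e in v1 v2.
rewrite -natr1 in u2 v2.
rewrite real_ler_norml ?realB ?ger0_real //.
apply/andP; split.
  by rewrite lerBrDr addrC lerBlDr (le_trans (ltW v2)) // lerD2r.
by rewrite lerBlDl (le_trans (ltW u2)) // lerD2r.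
Qed.

Section Geometry.
Variables (K : fieldExtType rat) (d : nat) (sigma : 'I_d -> {rmorphism K -> algC}).
Variable theta : K.
Hypothesis hK : totally_real K.
Hypothesis hB : totally_positive_power_basis sigma theta.
Local Notation O := (@ring_of_integers K).
Local Notation N := (conj_norm sigma).
Implicit Types x y : K.

(** A pigeonhole form of Minkowski's theorem: two of the [(H + 1) ^ d] combinations of powers with
    coefficients up to [H] share a cell with sides [b i], and their difference is small. *)
Lemma small_nonzero_integer : exists2 E : nat, (0 < E)%N &
  forall b : 'I_d -> algC, (forall i, 0 < b i) -> E%:R ^+ d <= \prod_i b i ->
  exists2 x, O x /\ x != 0 & forall i, `|sigma i x| <= b i.
Proof.
have [[Oth th_gt0] _ _ _] := hB; have d_gt0 := dim_gt0 hB.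
have [E E_gt0 hE] := power_basis_box hK hB.
exists E.*2 => [|b b_gt0 b_prod]; first by rewrite double_gt0.
(* Since [H >= b i], also [H * E / b i >= 1], so at most [2 * H * E / b i] cells are needed in
   direction [i]. The doubled constant then keeps the number of cells at most [H ^ d]. *)
have [|H H_gt0 bH] := @real_family_bound _ b; first by move=> i; rewrite gtr0_real.
have HEb i : 1 <= (H * E)%:R / b i.
  rewrite ler_pdivlMr // mul1r; apply: le_trans (bH i) _.
  by rewrite ler_nat leq_pmulr.
pose pt (h : {ffun 'I_d -> 'I_H.+1}) : K := \sum_k (h k)%:R *: theta ^+ k.
have ptb h i : 0 <= sigma i (pt h) <= (H * E)%:R.
  by apply: hE => k; rewrite ler0n ler_nat -ltnS ltn_ord.
pose n i := Num.truncn ((H * E)%:R / b i).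
pose cell (h : {ffun 'I_d -> 'I_H.+1}) : {dffun forall i : 'I_d, 'I_(n i).+1} :=
  [ffun i => inord (Num.truncn (sigma i (pt h) / b i))].
have [/injectiveP/leq_card|/injectivePn [g [h ne_gh]]] := boolP (injectiveb cell).
  rewrite card_ffun !card_ord card_dep_ffun foldrE big_map enumT -/(index_enum _).
  under eq_bigr do rewrite card_ord.
  rewrite -(ler_nat algC) natrX natr_prod => le_cells.
  have : \prod_i ((n i).+1%:R : algC) <= H%:R ^+ d.
    apply: (@le_trans _ _ (\prod_i (H%:R * E.*2%:R / b i))).
      apply: ler_prod => i _; rewrite ler0n /= -natr1 -muln2 natrM mulrA -natrM.
      rewrite mulr_natr mulrnAl mulr2n lerD //.
      by have /andP [] := truncn_itv (le_trans ler01 (HEb i)).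
    rewrite big_split prodfV /= big_split /= !prodr_const card_ord.
    rewrite -mulrA ler_piMr ?exprn_ge0 // ler_pdivrMr ?mul1r //.
    by apply: prodr_gt0.
  move=> /(le_trans le_cells); rewrite ler_pXn2r ?nnegrE //.
  by rewrite ler_nat ltnn.
move=> eq_cell; exists (pt g - pt h); first split.
- have Opt f : O (pt f).
    apply: integer_sum => k; rewrite scaler_nat -mulr_natl.
    by apply: integerM; [apply: integer_nat | apply: integerX].
  exact: integerB.
- apply: contraNneq ne_gh => pt0; apply/eqP/ffunP => k; apply: val_inj => /=.
  apply/eqP; rewrite -(eqr_nat algC) -subr_eq0; apply/eqP.
  apply: (@conj_pow_sum_eq0 _ _ _ _ hB (fun k => (g k)%:R - (h k)%:R)) => i.
  rewrite -[RHS](rmorph0 (sigma i)) -pt0 rmorphB !rmorph_sum -sumrB.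
  by apply: eq_bigr => j _; rewrite !scaler_nat !rmorphMn rmorphXn mulrBl !mulr_natl.
- move=> i; have /andP [g0 gle] := ptb g i; have /andP [h0 hle] := ptb h i.
  have b0 := b_gt0 i.
  have cell_lt f : (Num.truncn (sigma i (pt f) / b i) < (n i).+1)%N.
    rewrite ltnS; apply: le_truncn; rewrite ler_pM2r ?invr_gt0 //.
    by have /andP [] := ptb f i.
  have := congr1 (fun c : {dffun forall i : 'I_d, 'I_(n i).+1} => val (c i)) eq_cell.
  rewrite /= !ffunE !inordK // => e.
  have := dist_eq_truncn _ _ e; rewrite -mulrBl normrM normfV (gtr0_norm b0).
  rewrite ler_pdivrMr // mul1r -rmorphB => -> //; apply: divr_ge0 => //; exact: ltW.
Qed.

(** At one embedding, [n / x] is up to sign the product of the other conjugates, hence an algebraic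
    integer. *)
Lemma integer_norm_div x (n : nat) : O x -> x != 0 ->
  `|N x| = n%:R -> O (n%:R / x).
Proof.
move=> Ox x0 eN; have i0 : 'I_d by apply: (Ordinal (dim_gt0 hB)).
have sx0 : sigma i0 x != 0 by rewrite fmorph_eq0.
have co : N x / sigma i0 x \in Aint.
  rewrite /conj_norm (bigD1 i0) //= mulrC mulKf //.
  by apply: rpred_prod => i _; apply: integer_Aint.
apply: (@Aint_integer _ (sigma i0)); rewrite rmorphM fmorphV rmorph_nat -eN.
have /Rreal_int N_real := conj_norm_int hB Ox.
by case: (real_ge0P N_real) => _ //; rewrite mulNr rpredN.
Qed.

Lemma conj_norm_ge1 x : O x -> x != 0 -> 1 <= `|N x|.
Proof.
move=> Ox x0; apply: norm_intr_ge1; first exact: (conj_norm_int hB).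
by apply/prodf_neq0 => i _; rewrite fmorph_eq0.
Qed.

Lemma unit_quotient x y : O (x / y) -> O (y / x) -> x != 0 -> y != 0 ->
  unit_group (x / y).
Proof.
move=> Oxy Oyx x0 y0; split=> //; exists (y / x) => //.
by rewrite mulrA divfK // divff.
Qed.

(* Two integers with the same norm [n] up to sign and congruent modulo [n]
   are associate, and residues modulo [n] have representatives in a box. *)
Lemma finite_bounded_norm_classes (B : nat) : exists s : seq K,
  (forall y, y \in s -> y != 0) /\
  forall x, O x -> x != 0 -> `|N x| <= B%:R ->
  exists2 y, y \in s & unit_group (x / y).
Proof.
have [[Oth th_gt0] _ _ _] := hB; have [E E_gt0 hE] := power_basis_box hK hB.
have [residues resP] := finite_box hK hB (B * E).
pose Q x (p : K * nat) := [/\ O x, x != 0, `|N x| = p.2%:R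
  & exists2 w, O w & x = p.2%:R * w + p.1].
(* [rep] fixes one integer for each pair of a residue and a norm that occurs; [None] marks the other
   pairs. *)
have /choice [rep repP] : forall p, exists o : option K,
    (forall y, o = Some y -> Q y p) /\ (forall x, Q x p -> o <> None).
  move=> p; have [[y Qy]|nQ] := pselect (exists y, Q y p).
    by exists (Some y); split => // _ [<-].
  by exists None; split => // x Qx; case: nQ; exists x.
pose pairs := [seq (r, n) | r <- residues, n <- iota 0 B.+1].
exists (pmap rep pairs); split.
  move=> y; rewrite mem_pmap => /mapP [p _ /esym ep].
  by have [/(_ y ep) []] := repP p.
move=> x Ox x0 xB.
have N_int := conj_norm_int hB Ox.
pose n := Num.truncn `|N x|.
have en : `|N x| = n%:R.
  by rewrite truncnK // natr_norm_int.
have n_le : (n <= B)%N by rewrite -(ler_nat algC) -en.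
have n_gt0 : (0 < n)%N by rewrite -(ltr_nat algC) -en (lt_le_trans ltr01) // conj_norm_ge1.
have [z [f [hf ex]]] := power_basis_division hB x n_gt0.
set w := \sum_k _ in ex; set r := \sum_k _ in ex.
have Ow : O w.
  apply: integer_sum => k; apply: integerM; [exact: integer_int | exact: integerX].
have Or : O r.
  have -> : r = x - n%:R * w by rewrite ex addrC addKr.
  by apply: integerB => //; apply: integerM => //; exact: integer_nat.
have r_in : r \in residues.
  apply: resP => // i.
  have [|r0 r1] := andP (hE n f _ i).
    by move=> k; have /andP [-> /ltW ->] := hf k.
  by rewrite ger0_norm //; apply: le_trans r1 _; rewrite ler_nat leq_mul2r n_le orbT.
have Qx : Q x (r, n) by split => //; exists w.
have [repQ /(_ x Qx)] := repP (r, n).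
case erep: (rep (r, n)) => [y|//] _.
have [/= Oy y0 eny [w' Ow' ey]] := repQ y erep.
exists y.
  rewrite mem_pmap; apply/mapP; exists (r, n); last by rewrite erep.
  by apply/allpairsP; exists (r, n); split; rewrite ?mem_iota /= ?ltnS.
(* Here [n / a] is integral because [n] is the norm of [a] up to sign; using this in both directions
   makes [x / y] a unit. *)
have quot a b wa wb : O a -> a != 0 -> `|N a| = n%:R -> O wa -> O wb ->
    a = n%:R * wa + r -> b = n%:R * wb + r -> O (b / a).
  move=> Oa a0 eNa Owa Owb ea eb.
  have -> : b / a = 1 + n%:R / a * (wb - wa).
    by apply: (mulIf a0); rewrite divfK // mulrDl mulrAC divfK // {1}ea eb; ring.
  apply: integerD; first exact: (integer_nat _ 1).
  by apply: integerM; [apply: integer_norm_div | apply: integerB].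
by apply: unit_quotient => //; [apply: (quot y x w' w) | apply: (quot x y w w')].
Qed.

(** Let [t] be the geometric mean of the square roots [q i] of the conjugates of [g]. The box with
    sides [E * t / q i] contains a nonzero integer [x] of norm at most [E ^ d], a unit [u] times
    some listed [y]. The conjugates of [g * u ^ 2] are then at most [D * t ^ 2], and their product
    is at least [t ^ (2d)], which bounds each of them below. *)
Lemma balancing_unit : exists2 C : nat, (0 < C)%N &
  forall g, (forall i, 0 < sigma i g) ->
  exists2 u, unit_group u &
    forall i j, sigma i (g * u ^+ 2) <= C%:R * sigma j (g * u ^+ 2).
Proof.
have d_gt0 := dim_gt0 hB.
have [E E_gt0 hE] := small_nonzero_integer.
have [s [s0 sP]] := finite_bounded_norm_classes (E ^ d).
have [|A A_gt0 hA] := @real_family_bound _ (fun p : 'I_(size s) * 'I_d =>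
    (sigma p.2 s`_p.1 ^+ 2)^-1).
  by move=> p; rewrite realV realX // sigma_real.
(* [E ^ 2] comes from the box and [A] from dividing by the square of a listed [y]. *)
pose D := (E ^ 2 * A)%N.
exists (D ^ d)%N => [|g g_gt0]; first by rewrite expn_gt0 muln_gt0 expn_gt0 E_gt0 A_gt0.
pose q i := sqrtC (sigma i g).
have q_gt0 i : 0 < q i by rewrite sqrtC_gt0.
have qK i : q i ^+ 2 = sigma i g by rewrite sqrtCK.
have q_prod_gt0 : 0 < \prod_i q i by apply: prodr_gt0.
pose t := d.-root (\prod_i q i).
have tK : t ^+ d = \prod_i q i by rewrite rootCK.
have t_gt0 : 0 < t by rewrite rootC_gt0.
have E0 : 0 < E%:R :> algC by rewrite ltr0n.
have [|//|x [Ox x0] xb] := hE (fun i => E%:R * t / q i).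
- by move=> i; rewrite divr_gt0 // mulr_gt0.
- rewrite big_split prodfV /= prodr_const card_ord exprMn tK mulfK ?gt_eqF //.
have [|y ys uxy] := sP x Ox x0.
  rewrite /conj_norm normr_prod natrX.
  apply: (@le_trans _ _ (\prod_i (E%:R * t / q i))).
    by apply: ler_prod => i _; rewrite normr_ge0 xb.
  by rewrite big_split prodfV /= prodr_const card_ord exprMn tK mulfK ?gt_eqF.
have y0 := s0 y ys.
pose u := x / y; pose v i := sigma i (g * u ^+ 2).
have u0 : u != 0 by rewrite mulf_neq0 ?invr_eq0.
have [Ou _] := uxy; rewrite -/u in Ou uxy.
exists u => // i j; rewrite -/(v i) -/(v j).
have sq_gt0 (z : K) k : z != 0 -> 0 < sigma k z ^+ 2.
  by move=> z0; rewrite -real_normK ?sigma_real // exprn_gt0 // normr_gt0 fmorph_eq0.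
have v_gt0 k : 0 < v k by rewrite /v rmorphM rmorphXn mulr_gt0 // sq_gt0.
have D_gt0 : 0 < D%:R :> algC by rewrite ltr0n muln_gt0 expn_gt0 E_gt0.
have v_le k : v k <= D%:R * t ^+ 2.
  have yk : (sigma k y ^+ 2)^-1 <= A%:R.
    have lt_i : (index y s < size s)%N by rewrite index_mem.
    by have := hA (Ordinal lt_i, k); rewrite /= nth_index.
  rewrite /v /u rmorphM rmorphXn rmorphM fmorphV exprMn exprVn -qK mulrA -exprMn.
  rewrite natrM natrX [leRHS]mulrAC -[X in _ <= X * _]exprMn.
  apply: ler_pM => //; first by rewrite ltW // exprMn mulr_gt0 ?sq_gt0 // exprn_gt0.
    by rewrite invr_ge0 ltW // sq_gt0.
  rewrite -real_normK; last by rewrite realM ?sigma_real // gtr0_real.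
  rewrite ler_pXn2r ?nnegrE ?normr_ge0 ?mulr_ge0 ?(ltW E0) ?(ltW t_gt0) //.
  by rewrite normrM (gtr0_norm (q_gt0 k)) [leLHS]mulrC -ler_pdivlMr.
have v_prod : (t ^+ 2) ^+ d <= \prod_k v k.
  have -> : \prod_k v k = (t ^+ 2) ^+ d * `|N u| ^+ 2.
    rewrite exprAC tK -prodrXl real_normK; last first.
      by apply: Rreal_int; apply: (conj_norm_int hB).
    rewrite -prodrXl -big_split; apply: eq_bigr => k _ /=.
    by rewrite /v rmorphM rmorphXn qK.
  apply: ler_peMr; first by rewrite !exprn_ge0 // ltW.
  by rewrite exprn_ege1 // conj_norm_ge1.
have t2 : 0 < t ^+ 2 by rewrite exprn_gt0.
(* In the product bound, the [d - 1] factors other than [v j] are replaced by their upper bound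
   [D * t ^ 2]. *)
have v_ge : t ^+ 2 <= D%:R ^+ d.-1 * v j.
  rewrite -(ler_pM2r (exprn_gt0 d.-1 t2)) -exprS prednK //.
  apply: le_trans v_prod _; rewrite (bigD1 j) //= mulrC mulrAC.
  rewrite ler_pM2r // -exprMn.
  apply: (@le_trans _ _ (\prod_(k < d | k != j) (D%:R * t ^+ 2))).
    by apply: ler_prod => k _; rewrite v_le ltW.
  by rewrite prodr_const cardC1 card_ord.
have -> : (D ^ d)%N%:R = D%:R * D%:R ^+ d.-1 :> algC.
  by rewrite natrX -exprS prednK.
by rewrite -mulrA (le_trans (v_le i)) // ler_pM2l.
Qed.

End Geometry.

(** * Sums of elements of a finite set *)

Definition sum_of_members (V : zmodType) (T : seq V) (x : V) : Prop :=
  exists2 s : seq V, {subset s <= T} & x = \sum_(t <- s) t.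

Section SumOfMembers.
Variables (V : zmodType) (T : seq V).
Implicit Types x y : V.

Lemma sum_of_members0 : sum_of_members T 0.
Proof. by exists [::] => //; rewrite big_nil. Qed.

Lemma sum_of_members1 x : x \in T -> sum_of_members T x.
Proof.
move=> xT; exists [:: x]; last by rewrite big_seq1.
by move=> y; rewrite inE => /eqP ->.
Qed.

Lemma sum_of_membersD x y :
  sum_of_members T x -> sum_of_members T y -> sum_of_members T (x + y).
Proof.
move=> [s sT ->] [r rT ->]; exists (s ++ r); last by rewrite big_cat.
by move=> t; rewrite mem_cat => /orP [/sT|/rT].
Qed.

Lemma sum_of_membersMn x n : sum_of_members T x -> sum_of_members T (x *+ n).
Proof.
move=> hx; elim: n => [|n IH]; first exact: sum_of_members0.
by rewrite mulrS; apply: sum_of_membersD.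
Qed.

Lemma sum_of_members_sum (I : Type) (r : seq I) (F : I -> V) :
  (forall i, sum_of_members T (F i)) -> sum_of_members T (\sum_(i <- r) F i).
Proof.
move=> hF; elim/big_ind: _ => //; first exact: sum_of_members0.
exact: sum_of_membersD.
Qed.

End SumOfMembers.

(** * Totally positive integers and square classes *)

Section TotallyPositive.
Variable K : fieldExtType rat.
Local Notation O := (@ring_of_integers K).
Local Notation Oplus := (@totally_positive_integers K).
Implicit Types x y : K.

Lemma totally_positiveD x y : Oplus x -> Oplus y -> Oplus (x + y).
Proof.
move=> [Ox px] [Oy py]; split; first exact: integerD.
by move=> tau; rewrite rmorphD addr_gt0.
Qed.

Lemma totally_positive_add_sum x (s : seq K) :
  Oplus x -> (forall t, t \in s -> Oplus t) -> Oplus (x + \sum_(t <- s) t).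
Proof.
elim: s x => [|t s IH] x px ps; first by rewrite big_nil addr0.
rewrite big_cons addrA; apply: IH => [|v vs]; last by apply: ps; rewrite inE vs orbT.
by apply: totally_positiveD => //; apply: ps; exact: mem_head.
Qed.

Lemma totally_positive_square_mul x y : totally_real K ->
  Oplus x -> O y -> y != 0 -> Oplus (x * y ^+ 2).
Proof.
move=> hK [Ox px] Oy y0; split=> [|tau].
  by apply: integerM => //; apply: integerX.
rewrite rmorphM mulr_gt0 // rmorphXn -real_normK ?hK // exprn_gt0 //.
by rewrite normr_gt0 fmorph_eq0.
Qed.

Lemma unit_group_neq0 u : @unit_group K u -> u != 0.
Proof.
by move=> [_ [v _]] uv; apply/eqP => u0; move/eqP: uv; rewrite u0 mul0r eq_sym oner_eq0.
Qed.

Lemma unit_groupV u : @unit_group K u -> @unit_group K u^-1.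
Proof.
move=> hu; have u0 := unit_group_neq0 hu; case: hu => Ou [v Ov uv].
have -> : u^-1 = v by apply: (mulfI u0); rewrite mulfV.
by split=> //; exists u => //; rewrite mulrC.
Qed.

Lemma unit_groupM u v : @unit_group K u -> @unit_group K v -> @unit_group K (u * v).
Proof.
move=> [Ou [u' Ou' uu']] [Ov [v' Ov' vv']]; split; first exact: integerM.
by exists (u' * v'); [exact: integerM | rewrite mulrACA uu' vv' mulr1].
Qed.

Lemma square_class_mul_unit (beta x u : K) : @unit_group K u ->
  square_class beta (x * u ^+ 2) -> square_class beta x.
Proof.
move=> hu [v hv exv]; exists (v * u^-1).
  by apply: unit_groupM => //; exact: unit_groupV.
rewrite exprMn mulrA exv -mulrA -exprMn divff ?expr1n ?mulr1 //.
exact: unit_group_neq0.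
Qed.

(** If [x + y = beta * u ^ 2], division by [u ^ 2] would decompose [beta]. *)
Lemma sum_not_square_class (beta x y : K) : totally_real K -> indecomposable beta ->
  Oplus x -> Oplus y -> ~ square_class beta (x + y).
Proof.
move=> hK hind px py [u hu e]; have u0 := unit_group_neq0 hu.
have [Ov _] := unit_groupV hu; apply: hind.
have v0 : u^-1 != 0 by rewrite invr_eq0.
exists (x * u^-1 ^+ 2), (y * u^-1 ^+ 2); split; try exact: totally_positive_square_mul.
by rewrite -mulrDl -e -mulrA -exprMn divff // expr1n mulr1.
Qed.

End TotallyPositive.

(** * Finitely many summands up to unit squares *)

Section Decomposition.
Variables (K : fieldExtType rat) (d : nat) (sigma : 'I_d -> {rmorphism K -> algC}).
Variable theta : K.
Hypothesis hK : totally_real K.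
Hypothesis hB : totally_positive_power_basis sigma theta.
Local Notation O := (@ring_of_integers K).
Local Notation Oplus := (@totally_positive_integers K).
Implicit Types x y g : K.

Lemma totally_positive_sigma x : O x -> (forall i, 0 < sigma i x) -> Oplus x.
Proof.
have [_ _ _ all_emb] := hB => Ox px; split=> // tau.
by have [i ->] := all_emb tau.
Qed.

(* With [m] comparable to the conjugates of [g], division by [m] in the power
   basis gives [g = m * w + r], where [w] is bounded and totally positive and
   [r] is a sum of powers of [theta] and of a bounded fractional part. *)
Lemma balanced_sum_of_members (C : nat) : (0 < C)%N -> exists T : seq K,
  (forall t, t \in T -> Oplus t) /\
  forall g, Oplus g -> (forall i j, sigma i g <= C%:R * sigma j g) ->
  sum_of_members T g.
Proof.
move=> C_gt0; have [[Oth th_gt0] _ _ _] := hB.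
have [E E_gt0 hE] := power_basis_box hK hB.
(* With [m] the floor of [sigma i0 g / B], balance gives conjugates of [g] at least
   [m * B / C = 2 * m * E], above the bound [m * E] on the remainder, so [w] is totally positive.
   They are at most [C * (m + 1) * B <= m * B'] when [m > 0], so [w] lies in the box. *)
pose B := (C * E.*2)%N; pose B' := (C * B.*2)%N.
have [box boxP] := finite_box hK hB B'.
pose T := [seq t <- box | `[< Oplus t >]] ++ [seq theta ^+ (k : 'I_d) | k <- enum 'I_d].
have T_pow (k : 'I_d) : theta ^+ k \in T.
  by rewrite mem_cat [X in _ || X]map_f ?orbT // mem_enum.
have T_box x : O x -> (forall i, 0 < sigma i x <= B'%:R) -> x \in T.
  move=> Ox hx; rewrite mem_cat mem_filter boxP //=.
    rewrite andbT; apply/orP; left; apply/asboolP.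
    by apply: totally_positive_sigma => // i; have /andP [] := hx i.
  by move=> i; have /andP [x0 xle] := hx i; rewrite gtr0_norm.
have E_le_B' : (E <= B')%N by rewrite /B' /B -!muln2; nia.
exists T; split=> [t|g [Og pg] bal].
  rewrite mem_cat => /orP [|/mapP [k _ ->]].
    by rewrite mem_filter => /andP [/asboolP].
  apply: totally_positive_sigma => [|i]; first exact: integerX.
  by rewrite rmorphXn exprn_gt0.
have i0 : 'I_d by apply: (Ordinal (dim_gt0 hB)).
have B0 : 0 < B%:R :> algC by rewrite ltr0n /B -muln2; nia.
pose m := Num.truncn (sigma i0 g / B%:R).
have /andP [m_le m_lt] : m%:R <= sigma i0 g / B%:R < m.+1%:R.
  by apply: truncn_itv; rewrite divr_ge0 ?ltW.
rewrite ler_pdivlMr // in m_le; rewrite ltr_pdivrMr // in m_lt.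
have g_le i : sigma i g <= (C * (m.+1 * B))%:R.
  by apply: le_trans (bal i i0) _; rewrite natrM ler_wpM2l // natrM ltW.
have [m0|m_gt0] := posnP m.
  apply/sum_of_members1/T_box => // i; rewrite pg /=.
  apply: le_trans (g_le i) _; rewrite ler_nat m0 /B' -muln2; nia.
have g_ge i : (m * E.*2)%:R <= sigma i g.
  have C0 : 0 < C%:R :> algC by rewrite ltr0n.
  rewrite -(ler_pM2l C0) -natrM; apply: le_trans (bal i0 i).
  apply: le_trans m_le; rewrite -natrM ler_nat /B; nia.
have [z [f [hf eg]]] := power_basis_division hB g m_gt0.
set w := \sum_k _ in eg; set r := \sum_k _ in eg.
have Opow (c : 'I_d -> int) : O (\sum_k (c k)%:~R * theta ^+ k).
  by apply: integer_sum => k; apply: integerM; [exact: integer_int | exact: integerX].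
have r_bnd i : 0 <= sigma i r <= (m * E)%:R.
  by apply: hE => k; have /andP [-> /ltW ->] := hf k.
have m0 : 0 < m%:R :> algC by rewrite ltr0n.
have eg_sigma i : m%:R * sigma i w = sigma i g - sigma i r.
  by rewrite eg rmorphD rmorphM rmorph_nat addrK.
have wT : w \in T.
  apply: T_box => [|i]; first exact: Opow.
  have /andP [r0 rle] := r_bnd i.
  rewrite -(pmulr_rgt0 _ m0) -(ler_pM2l m0) eg_sigma; apply/andP; split.
    rewrite subr_gt0; apply: le_lt_trans rle _; apply: lt_le_trans (g_ge i).
    rewrite ltr_nat -muln2; nia.
  rewrite lerBlDr; apply: le_trans (g_le i) _; rewrite -natrM.
  apply: (@le_trans _ _ (m * B')%:R); last by rewrite lerDl.
  rewrite ler_nat /B' -muln2; nia.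
(* The integer parts of the coordinates of [r] contribute powers of [theta]; what remains is an
   integer with coordinates in the unit interval, so its conjugates are at most [E]. *)
pose n k := Num.truncn (f k).
have n_itv k : 0 <= f k - (n k)%:R <= 1.
  have /andP [f0 _] := hf k; have /andP [h1 h2] := truncn_itv f0.
  by rewrite subr_ge0 h1 lerBlDl natr1 ltW.
pose rho := \sum_k (f k - (n k)%:R) *: theta ^+ k.
have er : r = \sum_(k < d) theta ^+ k *+ n k + rho.
  rewrite /r /rho -big_split; apply: eq_bigr => k _ /=.
  by rewrite -scaler_nat -scalerDl addrC subrK.
have Orho : O rho.
  have -> : rho = g - m%:R * w - \sum_(k < d) theta ^+ k *+ n k by rewrite eg er; ring.
  apply: integerB; last first.
    apply: integer_sum => k; rewrite -mulr_natl.
    by apply: integerM; [exact: integer_nat | exact: integerX].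
  by apply: integerB => //; apply: integerM; [exact: integer_nat | exact: Opow].
rewrite eg er; apply: sum_of_membersD.
  by rewrite mulr_natl; apply/sum_of_membersMn/sum_of_members1.
apply: sum_of_membersD.
  by apply: sum_of_members_sum => k; apply/sum_of_membersMn/sum_of_members1.
(* A zero [rho] is not totally positive and is covered by the empty sum. *)
have [->|rho0] := eqVneq rho 0; first exact: sum_of_members0.
apply/sum_of_members1/T_box => // i.
have /andP [h0 h1] : 0 <= sigma i rho <= (1 * E)%:R by apply: hE.
rewrite lt_def h0 fmorph_eq0 rho0 /=; apply: le_trans h1 _.
by rewrite ler_nat mul1n.
Qed.

Lemma finitely_many_summands_up_to_squares : exists T : seq K,
  (forall t, t \in T -> Oplus t) /\
  forall g, Oplus g -> exists2 u, @unit_group K u & sum_of_members T (g * u ^+ 2).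
Proof.
have [C C_gt0 hC] := balancing_unit hK hB.
have [T [T_pos hT]] := balanced_sum_of_members C_gt0.
exists T; split=> // g pg; have [|u hu bal] := hC g; first by case: pg.
exists u => //; apply: hT => //; apply: totally_positive_square_mul => //.
  by case: hu.
exact: unit_group_neq0.
Qed.

End Decomposition.

(** * Representation by diagonal lattices *)

Section Diagonal.
Variable K : fieldExtType rat.
Local Notation O := (@ring_of_integers K).
Local Notation Oplus := (@totally_positive_integers K).

(** Coefficients in a list and coordinates indexed by [nat] make orthogonal sums plain
    concatenations, free of dependent index types. *)
Definition seq_represents (s : seq K) (g : K) : Prop :=
  exists2 x : nat -> K, (forall i, O (x i)) &
    \sum_(i < size s) s`_i * x i ^+ 2 = g.

Lemma seq_represents_diag (s : seq K) g :
  seq_represents s g -> diag_represents (fun i : 'I_(size s) => s`_i) g.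
Proof. by move=> [x Ox e]; exists (fun i => x i). Qed.

Lemma seq_represents_nil : seq_represents [::] 0.
Proof. by exists (fun=> 0) => [_|]; [exact: (integer_nat _ 0) | rewrite big_ord0]. Qed.

Lemma seq_represents_cat (s t : seq K) g h :
  seq_represents s g -> seq_represents t h -> seq_represents (s ++ t) (g + h).
Proof.
move=> [x Ox <-] [y Oy <-].
exists (fun i => if (i < size s)%N then x i else y (i - size s)%N).
  by move=> i; case: ifP.
rewrite size_cat big_split_ord /=; congr (_ + _); apply: eq_bigr => i _ /=.
  by rewrite nth_cat ltn_ord.
by rewrite nth_cat ltnNge leq_addr /= addKn.
Qed.

Lemma seq_represents1 (a x : K) : O x -> seq_represents [:: a] (a * x ^+ 2).
Proof. by move=> Ox; exists (fun=> x) => //; rewrite big_ord1. Qed.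

Lemma seq_represents_natmul (a : K) (n : nat) :
  seq_represents (nseq 4 a) (a *+ n).
Proof.
have [x [y [z [w e]]]] := lagrange_four_squares n.
have -> : a *+ n = a * x%:~R ^+ 2 + (a * y%:~R ^+ 2 + (a * z%:~R ^+ 2 + a * w%:~R ^+ 2)).
  by rewrite -mulr_natr pmulrn e !rmorphD !rmorphXn /= !mulrDr !addrA.
have ra (v : int) : seq_represents [:: a] (a * v%:~R ^+ 2).
  by apply: seq_represents1; exact: integer_int.
exact: (seq_represents_cat (ra x) (seq_represents_cat (ra y)
  (seq_represents_cat (ra z) (ra w)))).
Qed.

(** All summands equal to [a] are collected into one multiple of [a], represented by the four copies
    of [a]; the others come from the tail of [S]. *)
Lemma seq_represents_sum_of_members (S : seq K) g :
  sum_of_members S g -> seq_represents (flatten [seq nseq 4 a | a <- S]) g.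
Proof.
move=> [s sS ->].
elim: S s sS => [|a S IH] s sS.
  have -> : s = [::] by case: s sS => // x s /(_ x (mem_head _ _)).
  by rewrite big_nil; exact: seq_represents_nil.
rewrite (bigID (pred1 a)) /=.
apply: (@seq_represents_cat (nseq 4 a)).
  rewrite (eq_bigr (fun=> a)) => [|i /eqP //]; rewrite big_const_seq.
  by rewrite iter_addr_0; exact: seq_represents_natmul.
rewrite -big_filter; apply: IH => x; rewrite mem_filter => /andP [xa /sS].
by rewrite inE (negbTE xa).
Qed.

Lemma diag_represents_mul_unit n (a : 'I_n -> K) g u : @unit_group K u ->
  diag_represents a (g * u ^+ 2) -> diag_represents a g.
Proof.
move=> hu [x Ox e]; have u0 := unit_group_neq0 hu; have [Ov _] := unit_groupV hu.
exists (fun i => x i / u) => [i|]; first exact: integerM.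
apply: (mulIf (expf_neq0 2 u0)); rewrite -e mulr_suml; apply: eq_bigr => i _.
by rewrite exprMn exprVn -[LHS]mulrA divfK // expf_neq0.
Qed.

(* Indecomposability leaves a single nonzero term [a i * x i ^+ 2], and
   squarefreeness makes [x i] a unit. *)
Lemma diag_represents_squarefree_indecomposable n (a : 'I_n -> K) beta :
  totally_real K -> beta != 0 -> squarefree beta -> indecomposable beta ->
  (forall i, Oplus (a i)) -> diag_represents a beta ->
  exists i, square_class beta (a i).
Proof.
move=> hK beta0 hsf hind pa [x Ox e].
have term0 i : x i != 0 -> Oplus (a i * x i ^+ 2).
  by move=> xi0; apply: totally_positive_square_mul.
(* The alternative [Oplus y] will contradict indecomposability once one nonzero term is set
   apart. *)
have sum0 (P : pred 'I_n) : let y := \sum_(i | P i) a i * x i ^+ 2 in Oplus y \/ y = 0.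
  rewrite /=; elim/big_ind: _ => [|y z [py|->] [pz|->]|i _]; try by right.
  - by left; exact: totally_positiveD.
  - by left; rewrite addr0.
  - by left; rewrite add0r.
  - by right; rewrite addr0.
  - by have [->|/term0] := eqVneq (x i) 0; [right; rewrite expr0n mulr0 | left].
have [i xi0] : exists i, x i != 0.
  apply: contra_notP (negP beta0) => /forallNP all0; rewrite -e big1 // => i _.
  by have /negP := all0 i; rewrite negbK => /eqP ->; rewrite expr0n mulr0.
exists i; rewrite (bigD1 i) //= in e.
have [ps|s0] := sum0 (fun j => j != i).
  by case: hind; exists (a i * x i ^+ 2), (\sum_(j | j != i) a j * x j ^+ 2); split; auto.
rewrite s0 addr0 in e.
have hu : unit_group (x i) by apply: hsf => //; exists (a i); [case: (pa i) | rewrite mulrC].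
have := unit_group_neq0 hu; exists (x i)^-1; first exact: unit_groupV.
by rewrite -e -mulrA -exprMn divff // expr1n mulr1.
Qed.

(* A sum of at least two members of [T] splits into sums of two or three
   members, and these are decomposable, hence not in the class of [beta]. *)
Lemma sum_of_members_avoiding (T : seq K) (beta : K) : totally_real K ->
  indecomposable beta -> (forall t, t \in T -> Oplus t) ->
  exists S : seq K,
    (forall a, a \in S -> Oplus a /\ ~ square_class beta a) /\
    forall g, sum_of_members T g -> ~ square_class beta g -> sum_of_members S g.
Proof.
move=> hK hind pT.
pose T2 := [seq x + y | x <- T, y <- T]; pose T3 := [seq x + y | x <- T, y <- T2].
pose S := [seq t <- T | ~~ `[< square_class beta t >]] ++ T2 ++ T3.
have pT2 t : t \in T2 -> Oplus t.
  by move=> /allpairsP [[x y] /= [xT yT ->]]; apply: totally_positiveD; exact: pT.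
exists S; split=> [t|g [s sT ->]].
  rewrite !mem_cat mem_filter => /or3P [/andP [/asboolPn nb /pT pt]|t2|t3] //.
    split; first exact: pT2.
    move: t2 => /allpairsP [[x y] /= [xT yT ->]].
    by apply: sum_not_square_class => //; exact: pT.
  move: t3 => /allpairsP [[x y] /= [xT yT ->]].
  split; first by apply: totally_positiveD; [exact: pT | exact: pT2].
  by apply: sum_not_square_class => //; [exact: pT | exact: pT2].
have S2 x y : x \in T -> y \in T -> sum_of_members S (x + y).
  move=> xT yT; apply: sum_of_members1; rewrite !mem_cat.
  by apply/or3P/Or32; exact: allpairs_f.
have S3 x y z : x \in T -> y \in T -> z \in T -> sum_of_members S (x + (y + z)).
  move=> xT yT zT; apply: sum_of_members1; rewrite !mem_cat.
  by apply/or3P/Or33; apply: allpairs_f => //; exact: allpairs_f.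
have [k] := ubnP (size s); elim: k s sT => // k IH [|x [|y [|z s]]] sT /=.
- by move=> _ _; rewrite big_nil; exact: sum_of_members0.
- move=> _; rewrite big_seq1 => nb; apply: sum_of_members1.
  by rewrite mem_cat mem_filter sT ?mem_head // andbT; apply/orP; left; apply/asboolPn.
- by move=> _ _; rewrite big_cons big_seq1; apply: S2; apply: sT; rewrite !inE eqxx ?orbT.
have [xT yT zT] : [/\ x \in T, y \in T & z \in T].
  by split; apply: sT; rewrite !inE eqxx ?orbT.
move=> lt_k _; case: s sT lt_k => [|t s] sT lt_k.
  by rewrite !big_cons big_nil addr0; exact: S3.
(* With at least four summands, removing two leaves at least two, so the rest is again decomposable
   and outside the class of [beta]. *)
rewrite 2!big_cons addrA; apply: sum_of_membersD; first exact: S2.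
apply: IH => [v vs||]; first by apply: sT; rewrite in_cons in_cons vs !orbT.
  by move: lt_k => /=; lia.
rewrite big_cons big_cons; apply: sum_not_square_class => //; first exact: pT.
apply: totally_positive_add_sum => [|v vs]; apply/pT/sT; rewrite !inE ?eqxx ?vs ?orbT //.
Qed.

End Diagonal.

Theorem theorem4p2 (K : fieldExtType rat) (hK : totally_real K) (beta : K)
  (hbeta : totally_positive_integers beta)
  (hsf : squarefree beta)
  (hind : indecomposable beta) :
  diag_critical_classes (square_class beta).
Proof.
have [d [sigma [theta hB]]] := totally_real_power_basis hK.
have [T [pT hT]] := finitely_many_summands_up_to_squares hK hB.
have [S [pS hS]] := sum_of_members_avoiding hK hind pT.
pose L := flatten [seq nseq 4 a | a <- S].
have mem_L (i : 'I_(size L)) : L`_i \in S.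
  have /flatten_mapP [a aS] : L`_i \in L by rewrite mem_nth.
  by rewrite mem_nseq => /andP [_ /eqP ->].
have pL (i : 'I_(size L)) : totally_positive_integers L`_i by have [] := pS _ (mem_L i).
have i0 : 'I_d by apply: (Ordinal (dim_gt0 hB)).
have beta0 : beta != 0.
  by rewrite -(fmorph_eq0 (sigma i0)) gt_eqF //; case: hbeta.
exists beta => //; split=> //; exists (size L), (fun i => L`_i); split=> //.
  move=> /(diag_represents_squarefree_indecomposable hK beta0 hsf hind pL) [i].
  by have [] := pS _ (mem_L i).
(* The class of [beta] is stable under unit squares, so [g * u ^ 2] stays outside it and its
   summands can be regrouped into members of [S]. *)
move=> g pg ng; have [u hu gu] := hT g pg.
apply: (diag_represents_mul_unit hu); apply: seq_represents_diag.
apply: seq_represents_sum_of_members; apply: hS => // /(square_class_mul_unit hu).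
exact: ng.
Qed.
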